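(* Let $n\ge 4$ and $k\ge1$ be integers. Then \[ \gamma_{[k]R}(C_6\Box P_n)\le 6(n-2)\left\lceil\frac{k+4}{5}\right\rceil+12\left\lceil\frac{k+3-\left\lceil\frac{k+4}{5}\right\rceil}{3}\right\rceil\le\frac{6nk+54n+4k-4}{5}. \]
   Context: For a graph $G$ and $v\in V(G)$, $N(v)$ is the open neighborhood and $N[v]=N(v)\cup\{v\}$. For an integer $k\ge1$, a function $f:V(G)\to\{0,1,\dots,k+1\}$ is a $[k]$-Roman dominating function if for every vertex $v$ with $f(v)<k$ we have $\sum_{u\in N[v]}f(u)\ge k+|\{u\in N(v): f(u)>0\}|$. The weight of $f$ is $\sum_{v}f(v)$, and $\gamma_{[k]R}(G)$ is the minimum weight of a $[k]$-Roman dominating function on $G$. $C_m\Box P_n$ is the Cartesian product of the cycle $C_m$ (vertices $0,\dots,m-1$ mod $m$) and the path $P_n$ (vertices $0,\dots,n-1$): $(i,j)\sim(i',j')$ iff ($i=i'$ and $|j-j'|=1$) or ($j=j'$ and $i'\equiv i\pm1 \pmod m$). *)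

(* Defs.v *)
From mathcomp Require Import all_boot all_order all_algebra.

Set Implicit Arguments.
Unset Strict Implicit.
Unset Printing Implicit Defensive.

(* A graph is an adjacency relation [e : rel T] on the finite
   vertex type [T]; all quantities in this file are natural numbers. *)

Section KRoman.
Variables (T : finType) (e : rel T).

Definition open_nbh (v : T) : {set T} := [set u | e v u].
Definition closed_nbh (v : T) : {set T} := v |: open_nbh v.

Variable k : nat.

(* The codomain ['I_k.+2] is {0, 1, ..., k+1}. *)
Definition is_kRDF (f : {ffun T -> 'I_k.+2}) : bool :=
  [forall v, (f v < k) ==>
     (k + #|[set u in open_nbh v | 0 < f u]| <= \sum_(u in closed_nbh v) f u)].

Definition weight (f : {ffun T -> 'I_k.+2}) : nat := \sum_v f v.

(* The constant function k+1 is a [k]-Roman dominating function on every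
   graph (see [kRDF_max]), so the minimum is over a nonempty set. *)
Definition gamma_kR : nat :=
  weight [arg min_(f < [ffun=> ord_max] | is_kRDF f) weight f].

Lemma kRDF_max : is_kRDF [ffun=> ord_max].
Proof. by apply/forallP => v; rewrite ffunE /= ltnNge leqnSn. Qed.

Lemma gamma_kR_attained : exists2 f, is_kRDF f & weight f = gamma_kR.
Proof.
rewrite /gamma_kR; case: arg_minnP => [|f Pf _]; first exact: kRDF_max.
by exists f.
Qed.

Lemma gamma_kR_min f : is_kRDF f -> gamma_kR <= weight f.
Proof.
rewrite /gamma_kR; case: arg_minnP => [|g _ g_min]; first exact: kRDF_max.
exact: g_min.
Qed.

End KRoman.

(* For m <= 2 this is not the simple graph C_m (loop for m = 1, an edge for
   m = 2). *)
Definition cycle_rel (m : nat) : rel 'I_m :=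
  fun i i' => (i' == i.+1 %[mod m]) || (i == i'.+1 %[mod m]).

Definition path_rel (n : nat) : rel 'I_n :=
  fun j j' => (j' == j.+1 :> nat) || (j == j'.+1 :> nat).

Definition cart_rel (S T : finType) (d : rel S) (e : rel T) : rel (S * T) :=
  fun x y => ((x.1 == y.1) && e x.2 y.2) || ((x.2 == y.2) && d x.1 y.1).

Definition cyl_rel (m n : nat) : rel ('I_m * 'I_n) :=
  cart_rel (@cycle_rel m) (@path_rel n).

Arguments cyl_rel : clear implicits.

Lemma cyl_rel_sym m n : symmetric (cyl_rel m n).
Proof.
move=> x y; rewrite /cyl_rel /cart_rel /cycle_rel /path_rel.
rewrite (eq_sym y.1) (eq_sym y.2).
by congr ((_ && _) || (_ && _)); rewrite orbC.
Qed.

Lemma cyl_rel_irr m n : 1 < m -> irreflexive (cyl_rel m n).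
Proof.
move=> m_gt1 x; rewrite /cyl_rel /cart_rel /cycle_rel /path_rel !eqxx /= !orbb.
rewrite ltn_eqF //= -addn1 -[X in X == _ %[mod m]]addn0 eqn_modDl.
by rewrite mod0n modn_small.
Qed.

(* Main.v *)
(* Let f take the value a = ceil((k+4)/5) on the inner copies of C_6 and
   b = ceil((k+3-a)/3) on the two end copies. Since f > 0, a vertex v needs
   f(N[v]) >= k + deg v: this is 3b + a >= k + 3 on an end copy, 4a + b >= k + 4
   next to it, and 5a >= k + 4 elsewhere. The closed bound follows from
   5a <= k + 8 and 3b <= k + 5 - a. *)
Require Import Defs.
From mathcomp Require Import all_boot all_order all_algebra.
From mathcomp Require Import zify lra.

Import Order.TTheory GRing.Theory Num.Theory.

Lemma cycle_relE m (i i' : 'I_m) :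
  cycle_rel i i' = (i' == ordS i) || (i' == ord_pred i).
Proof.
rewrite /cycle_rel !(modn_small (ltn_ord _)); congr (_ || _).
by rewrite -[i' == ord_pred i](can_eq (@ordSK m)) ord_predK eq_sym.
Qed.

Lemma card_cycle_rel m (i : 'I_m) : 2 < m -> #|cycle_rel i| = 2.
Proof.
move=> m_gt2.
have neq : ordS i != ord_pred i.
  (* After applying [ordS], it remains that i + 2 and i differ mod m; reduction wraps around only
     for i = m - 1 and i = m - 2. *)
  rewrite -(inj_eq (@ordS_inj m)) ord_predK -val_eqE /=.
  have lt_im := ltn_ord i.
  have [Em|neq_m] := eqVneq i.+1 m.
    by rewrite Em modnn modn_small; lia.
  rewrite (@modn_small i.+1); last by lia.
  have [Em|neq_m2] := eqVneq i.+2 m; first by rewrite Em modnn; lia.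
  by rewrite modn_small; lia.
have -> : 2 = #|[set ordS i; ord_pred i]| by rewrite cards2 neq.
by apply: eq_card => i'; rewrite !inE -cycle_relE.
Qed.

(** The two neighbours in the same copy of the cycle share the second coordinate of [v]; all others
    lie along the path. *)
Lemma sum_open_nbh_cyl m n (h : 'I_n -> nat) (v : 'I_m * 'I_n) : 2 < m ->
  \sum_(u in open_nbh (cyl_rel m n) v) h u.2 =
  \sum_(j | path_rel v.2 j) h j + 2 * h v.2.
Proof.
case: v => i j m_gt2 /=.
rewrite (bigID (fun u => u.2 == j)) /= addnC; congr (_ + _).
  rewrite (eq_bigl (fun u : 'I_m * 'I_n => (u.1 == i) && path_rel j u.2)).
    by rewrite -(pair_big (pred1 i) (path_rel j) (fun _ => h)) big_pred1_eq.
  move=> [i' j']; rewrite !inE /cyl_rel /cart_rel /=.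
  rewrite [j' == j]eq_sym [i' == i]eq_sym.
  case: (j =P j') => [<-|_] /=; last by rewrite orbF andbT.
  by rewrite /path_rel; lia.
rewrite (eq_bigl (fun u : 'I_m * 'I_n => cycle_rel i u.1 && (u.2 == j))).
  rewrite -(pair_big (cycle_rel i) (pred1 j) (fun _ => h)) /=.
  under eq_bigr do rewrite big_pred1_eq.
  by rewrite sum_nat_const card_cycle_rel.
move=> [i' j']; rewrite !inE /cyl_rel /cart_rel /= [j' == j]eq_sym.
case: (j =P j') => [<-|_] /=; last by rewrite !andbF.
by rewrite !andbT /path_rel; case: cycle_rel; lia.
Qed.

Lemma sum_path_rel n (h : nat -> nat) (j : 'I_n) :
  \sum_(j' | path_rel j j') h j' =
  (if 0 < j then h j.-1 else 0) + (if j.+1 < n then h j.+1 else 0).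
Proof.
rewrite -(big_mkord (fun j' => (j' == j.+1) || (nat_of_ord j == j'.+1)) h).
have lt_jn := ltn_ord j.
rewrite (bigID (fun j' => j' < j)) /=; congr (_ + _).
  rewrite (eq_bigl (fun j' => (0 < j) && (j' == j.-1))) => [|j']; last by lia.
  case: (posnP j) => [_|j_gt0] /=; first by rewrite big_pred0.
  by rewrite big_nat1_eq; case: ifP; lia.
rewrite (eq_bigl (fun j' => j' == j.+1)) => [|j']; last by lia.
by rewrite big_nat1_eq.
Qed.

(** Spread [h] constantly over each copy of the cycle. Positivity makes every neighbour count, so
    f(N[v]) >= k + deg v suffices; the two cycle neighbours give the 2 in [k + 2] and, with [v]
    itself, the term [3 * h j]. *)
Lemma gamma_kR_cyl_le m n k (h : nat -> nat) : 2 < m ->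
    (forall j, 0 < h j <= k.+1) ->
    (forall j : 'I_n, k + 2 + \sum_(j' | path_rel j j') 1 <=
       3 * h j + \sum_(j' | path_rel j j') h j') ->
  gamma_kR (cyl_rel m n) k <= m * \sum_(j < n) h j.
Proof.
move=> m_gt2 h_bnd h_dom.
pose f := [ffun u : 'I_m * 'I_n => inord (h u.2) : 'I_k.+2].
have fE u : f u = h u.2 :> nat.
  by rewrite ffunE inordK //; case/andP: (h_bnd u.2).
have -> : m * \sum_(j < n) h j = weight f.
  rewrite /weight; under [RHS]eq_bigr do rewrite fE.
  rewrite -(pair_bigA _ (fun (_ : 'I_m) (j : 'I_n) => h j)) /=.
  by rewrite sum_nat_const card_ord.
apply: gamma_kR_min; apply/forallP => v; apply/implyP => _.
rewrite big_setU1 /=; last by rewrite inE cyl_rel_irr // (ltnW m_gt2).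
under eq_bigr do rewrite fE.
rewrite fE (@sum_open_nbh_cyl m n (fun j => h j)) //.
have -> : [set u in open_nbh (cyl_rel m n) v | 0 < f u] =
          open_nbh (cyl_rel m n) v.
  apply/setP => u; rewrite !inE fE.
  by case/andP: (h_bnd u.2) => -> _; rewrite andbT.
(* The degree is the neighbourhood sum of the constant 1. *)
rewrite -sum1_card (@sum_open_nbh_cyl m n (fun=> 1)) //.
rewrite muln1 [_ + 2]addnC addnA [_ + 2 * _]addnC addnA -mulSn.
exact: h_dom.
Qed.

Lemma sum_ends n a b : 1 < n ->
  \sum_(j < n) (if (0 < j) && (j.+1 < n) then a else b) = (n - 2) * a + 2 * b.
Proof.
case: n => [|[|n]] // _.
rewrite big_ord_recl big_ord_recr /= ltnn.
rewrite (eq_bigr (fun=> a)) => [|j _]; last by rewrite /bump /= add1n !ltnS ltn_ord.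
by rewrite sum_nat_const card_ord; lia.
Qed.

(* The two intervals characterise [a] and [b] as the ceilings of [(k + 4) / 5]
   and [(k + 3 - a) / 3]. *)
Lemma gamma_kR_cyl_ends m n k a b : 2 < m -> 3 < n -> 0 < k ->
    k + 4 <= 5 * a < k + 9 -> k + 3 <= 3 * b + a < k + 6 ->
  gamma_kR (cyl_rel m n) k <= m * ((n - 2) * a + 2 * b).
Proof.
move=> m_gt2 n_gt3 k_gt0 a_itv b_itv.
rewrite -sum_ends; last by lia.
apply: (@gamma_kR_cyl_le m n k (fun j => if (0 < j) && (j.+1 < n) then a else b)).
- exact: m_gt2.
(* Positivity of [b] uses the upper bound on [a]; [a] and [b] are at most k + 1 because k >= 1. *)
- by move=> j; case: ifP => _; lia.
- move=> j; have := ltn_ord j.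
  rewrite (@sum_path_rel n (fun=> 1)).
  rewrite (@sum_path_rel n (fun i => if (0 < i) && (i.+1 < n) then a else b)).
  (* As n > 3, no copy adjoins both ends. Next to an end, 3(4a + b) = (3b + a) + 11a >= 3k + 12. *)
  by do !case: ifP => /=; lia.
Qed.

Local Open Scope ring_scope.

Theorem theorem10 (n k : nat) (n_ge4 : (4 <= n)%N) (k_ge1 : (1 <= k)%N) :
  let a : rat := (Num.ceil ((k%:R + 4) / 5 : rat))%:~R in
  let b : rat := (Num.ceil ((k%:R + 3 - a) / 3 : rat))%:~R in
  (gamma_kR (cyl_rel 6 n) k)%:R <= 6 * (n%:R - 2) * a + 12 * b
    <= (6 * n%:R * k%:R + 54 * n%:R + 4 * k%:R - 4) / 5.
Proof.
cbv zeta.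
have /andP[] := ceil_itv ((k%:R + 4) / 5 : rat).
move: (Num.ceil (_ / 5)) => a.
have /andP[] := ceil_itv ((k%:R + 3 - a%:~R) / 3 : rat).
move: (Num.ceil (_ / 3)) => b.
rewrite !intrB => b_lt b_ge a_lt a_ge.
have Ek : k%:R = k%:Z%:~R :> rat by [].
(* Clearing denominators in x <= ceil x < x + 1 gives integer intervals, which also force [a] and
   [b] to be nonnegative. *)
have a_itv : (k%:Z + 4 <= 5 * a < k%:Z + 9).
  rewrite -!(ler_int rat) -!(ltr_int rat) !rmorphD !rmorphM /= -Ek; lra.
have b_itv : (k%:Z + 3 <= 3 * b + a < k%:Z + 6).
  rewrite -!(ler_int rat) -!(ltr_int rat) !rmorphD !rmorphM /= -Ek; lra.
case: a a_itv b_itv a_lt a_ge b_lt b_ge => a a_itv; last by lia.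
case: b => b b_itv; last by lia.
move=> a_lt a_ge b_lt b_ge.
have n_ge4' : 4 <= n%:R :> rat by rewrite (ler_nat _ 4).
apply/andP; split.
  have -> : 6 * (n%:R - 2) * a%:~R + 12 * b%:~R =
      (6 * ((n - 2) * a + 2 * b))%N%:R :> rat.
    rewrite natrM natrD !natrM natrB; last by lia.
    by rewrite -!pmulrn; lra.
  by rewrite ler_nat; apply: gamma_kR_cyl_ends; lia.
(* Eliminating [b] by 3b < k + 6 - a leaves [a] with coefficient 6n - 16, positive since n >= 4;
   multiply it by 5a < k + 9. *)
nra.
Qed.
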